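(* Let $\mathcal C$ be a conilpotent dg coproperad and let $A$ and $B$ be two dg vector spaces. A triple $(\alpha,f,\beta)$ is a Maurer--Cartan element in the shifted $\mathrm L_\infty$-algebra $\mathfrak k_{\mathcal C,A,B}$ (that is, $s\alpha+f+s\beta$ is a degree $0$ solution of the Maurer--Cartan equation) if and only if $(A,\alpha)$ and $(B,\beta)$ are two $\Omega\mathcal C$-gebras and $f$ is an $\infty$-morphism $(A,\alpha)\rightsquigarrow(B,\beta)$.
   Context: $\mathbb{k}$ is a field of characteristic $0$; dg vector spaces are $\mathbb Z$-graded chain complexes over $\mathbb k$ (differentials of degree $-1$); $s,s^{-1}$ denote suspension and desuspension. An $\mathbb S$-bimodule $M$ is a family of dg vector spaces $M(m,n)$ ($m$ outputs, $n$ inputs) with commuting left $\mathbb S_m$- and right $\mathbb S_n$-actions; the $\mathbb S$-bimodules (such as $\mathcal C$) are assumed either left reduced ($M(0,n)=0$) or right reduced ($M(m,0)=0$). The connected composition product $M\boxtimes N$ is spanned by connected directed 2-level graphs with bottom vertices labelled by $M$ and top vertices labelled by $N$; its unit $\mathcal I$ is spanned by $\mathrm{id}$ in arity $(1,1)$. A dg properad (resp. dg coproperad) is a monoid (resp. comonoid) for $\boxtimes$. A coaugmented dg coproperad is $\mathcal C=\mathcal I\oplus\overline{\mathcal C}$ with decomposition map $\Delta$ and differential $d_{\mathcal C}$. The infinitesimal decomposition map $\Delta_{(1,1)}$ splits an element of $\overline{\mathcal C}$ into two elements of $\overline{\mathcal C}$ along connected graphs with two vertices. The cobar construction $\Omega\mathcal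 C$ is the free properad $\mathcal G(s^{-1}\overline{\mathcal C})$ with differential induced by $d_{\mathcal C}$ and $\Delta_{(1,1)}$. Conilpotent dg coproperad: $\Delta$ comes from a comonadic decomposition map $\widetilde\Delta:\overline{\mathcal C}\to\bigoplus_{\mathrm g}\mathrm g(\overline{\mathcal C})$ (sum over reduced directed connected graphs) and $d_{\mathcal C}(\mathscr R_k\overline{\mathcal C})\subset\mathscr R_{k-1}\overline{\mathcal C}$ for $k\ge1$, where $\mathscr R_k\overline{\mathcal C}$ consists of those $c$ with $\widetilde\Delta(c)$ supported on graphs with at most $k$ vertices. $\mathrm{End}_A(m,n)=\mathrm{Hom}(A^{\otimes n},A^{\otimes m})$, $\mathrm{End}^A_B(m,n)=\mathrm{Hom}(A^{\otimes n},B^{\otimes m})$; $\partial(f)=\partial_{\mathrm{End}}\circ f-(-1)^{|f|}f\circ d_{\mathcal C}$. On $\mathrm{Hom}_{\mathbb S}(\overline{\mathcal C},\mathrm{End}_A)$, $f\star g$ is $\Delta_{(1,1)}$ followed by $f$ on the bottom vertex, $g$ on the top vertex, and composition. An $\Omega\mathcal C$-gebra $(A,\alpha)$ is a morphism of dg properads $\Omega\mathcal C\to\mathrm{End}_A$, equivalently a degree $-1$ element $\alpha\in\mathrm{Hom}_{\mathbb S}(\overline{\mathcal C},\mathrm{End}_A)$ (extended by $0$ on $\mathcal I$) with $\partial(\alpha)+\alpha\star\alpha=0$. $\Delta_{(n)}:\mathcal C\to\overline{\mathcal C}\lhd_{(n)}\mathcal C$ is the projection of $\Delta$ onto 2-level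 graphs with exactly one bottom vertex labelled by $\overline{\mathcal C}$ (other bottom positions being $\mathrm{id}$) and exactly $n$ top vertices labelled by $\mathcal C$; ${}_{(n)}\Delta:\mathcal C\to\mathcal C\,{}_{(n)}\!\rhd\overline{\mathcal C}$ is the projection onto 2-level graphs with exactly one top vertex labelled by $\overline{\mathcal C}$ (other top positions being $\mathrm{id}$) and exactly $n$ bottom vertices labelled by $\mathcal C$; $\Delta_{( * )}=\sum_n\Delta_{(n)}$, ${}_{( * )}\Delta=\sum_n{}_{(n)}\Delta$; all vanish on $\mathcal I$. An $\infty$-morphism $f:(A,\alpha)\rightsquigarrow(B,\beta)$ is a degree $0$ element $f\in\mathrm{Hom}_{\mathbb S}(\mathcal C,\mathrm{End}^A_B)$ with $\partial(f)=f\rhd\alpha-\beta\lhd f$, where $\beta\lhd f$ is $\Delta_{( * )}$ followed by $\beta$ on the bottom vertex, $f$ on all top vertices, and composition, and $f\rhd\alpha$ is ${}_{( * )}\Delta$ followed by $\alpha$ on the top vertex, $f$ on all bottom vertices, and composition. The shifted $\mathrm L_\infty$-algebra $\mathfrak k_{\mathcal C,A,B}$ has underlying space $s\mathrm{Hom}_{\mathbb S}(\overline{\mathcal C},\mathrm{End}_A)\oplus\mathrm{Hom}_{\mathbb S}(\mathcal C,\mathrm{End}^A_B)\oplus s\mathrm{Hom}_{\mathbb S}(\overline{\mathcal C},\mathrm{End}_B)$, differential $-\partial$ (where $\partial(s\alpha)=-s\partial(\alpha)$), and operations $\mathcal k_2=[\,,]_A+[\,,]_B+\mathrm D_2-\mathrm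 U_2$, $\mathcal k_n=\mathrm D_n-\mathrm U_n$ for $n\ge3$. Here $[sf,sg]=(-1)^{|f|+1}s\big(f\star g-(-1)^{|f||g|}g\star f\big)$ on each of the two outer summands; with $f_1\odot\cdots\odot f_n=\sum_{\sigma\in\mathbb S_n}\pm f_{\sigma(1)}\otimes\cdots\otimes f_{\sigma(n)}$ (Koszul signs), $\mathrm U_{n+1}(s\beta,f_1,\dots,f_n)$ is $\Delta_{(n)}$ followed by $\beta\lhd_{(n)}(f_1\odot\cdots\odot f_n)$ and composition, and $\mathrm D_{n+1}(f_1,\dots,f_n,s\alpha)$ is $(-1)^{|f_1|+\cdots+|f_n|}$ times ${}_{(n)}\Delta$ followed by $(f_1\odot\cdots\odot f_n)\,{}_{(n)}\!\rhd\alpha$ and composition; both are extended to other orderings by graded symmetry and by zero to other types of arguments. Operations in a shifted $\mathrm L_\infty$-algebra are graded symmetric of degree $-1$. The algebra $\mathfrak k_{\mathcal C,A,B}$ is complete for a suitable decreasing filtration (equal to the whole space in filtration degree $1$), and a Maurer--Cartan element is a degree $0$ element $x$ with $d(x)+\sum_{n\ge2}\frac1{n!}\mathcal k_n(x,\dots,x)=0$.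
   Formalization: The sums over n defining β◁f and f▷α are taken over n ≥ 1; an n = 0 term (a bottom vertex with no top vertices, or a top vertex with no bottom vertices) has no counterpart among the operations k_n or the differential, and including it makes the equivalence false. *)

(* Defs.v *)
From HB Require Import structures.
From mathcomp Require Import all_boot all_order all_fingroup all_algebra.
From mathcomp Require Import boolp classical_sets functions.
Set Implicit Arguments.
Unset Strict Implicit.
Unset Printing Implicit Defensive.
Import GRing.Theory.
Local Open Scope ring_scope.

(** * Vector spaces given by generators and linear relations

    [rel phi] says that the function [phi] on the generators is compatible with
    the relations, i.e. that it is a linear form on the presented space [V].
    Over a field [V] embeds in its bidual, so [V] is realised as the set of
    functionals on these forms that are finite linear combinations of
    evaluations at valid generators. *)
Section Presented.
Variables (k : fieldType) (X : Type).
Variables (valid : X -> Prop) (rel : (X -> k) -> Prop).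

Definition form := {phi : X -> k | rel phi}.

Definition evalsum (s : seq (k * X)) : form -> k^o :=
  fun phi => \sum_(p <- s) p.1 * sval phi p.2.

Fixpoint all_prop (Q : X -> Prop) (s : seq (k * X)) : Prop :=
  if s is p :: s' then Q p.2 /\ all_prop Q s' else True.

Definition presented : {pred (form -> k^o)} :=
  fun F => `[< exists s, all_prop valid s /\ F = evalsum s >].

Lemma presented_submod : submod_closed presented.
Proof.
split=> [|a F G].
  apply/asboolP; exists [::]; split=> //; apply/funext => phi.
  by rewrite /evalsum big_nil.
move=> /asboolP[s [sV ->]] /asboolP[t [tV ->]]; apply/asboolP.
exists ([seq (a * p.1, p.2) | p <- s] ++ t); split.
  by elim: s sV => //= q s IH [qV /IH].
apply/funext => phi; rewrite /evalsum big_cat big_map /=; congr (_ + _).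
by rewrite [LHS]mulr_sumr; apply: eq_bigr => p _; rewrite mulrA.
Qed.

HB.instance Definition _ := GRing.isSubmodClosed.Build k (form -> k^o)%type
  presented presented_submod.

Record pres := Pres { pres_val :> form -> k^o; _ : pres_val \in presented }.

HB.instance Definition _ := [isSub for pres_val].
HB.instance Definition _ := [Choice of pres by <:].
HB.instance Definition _ := [SubChoice_isSubLmodule of pres by <:].

Lemma gen_subproof (x : X) :
  (fun phi : form => if `[< valid x >] then sval phi x else 0 : k^o)
    \in presented.
Proof.
apply/asboolP; case: asboolP => [xV|_].
  exists [:: (1, x)]; split=> //; apply/funext => phi.
  by rewrite /evalsum big_seq1 /= mul1r.
by exists [::]; split=> //; apply/funext => phi; rewrite /evalsum big_nil.
Qed.

(** The class of a generator, zero if the generator is not valid. *)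
Definition gen (x : X) : pres := Pres (gen_subproof x).

Lemma rep_subproof (v : pres) :
  exists s, all_prop valid s /\ pres_val v = evalsum s.
Proof. by case: v => F F_in; apply/asboolP; exact: F_in. Qed.

Definition rep (v : pres) : seq (k * X) := projT1 (cid (rep_subproof v)).

(** The linear map sending each valid generator [x] to [g x]; it does not depend
    on the representative chosen by [rep] when [g] satisfies the relations. *)
Definition lift (W : lmodType k) (g : X -> W) (v : pres) : W :=
  \sum_(p <- rep v) p.1 *: g p.2.

(** [v] is a linear combination of valid generators satisfying [Q]. *)
Definition span_in (Q : X -> Prop) (v : pres) : Prop :=
  exists s, [/\ all_prop valid s, all_prop Q s & pres_val v = evalsum s].

(** Independence of the representative, when the linear forms [h] such that
    [h \o g] satisfies the relations separate the points of [W]. *)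
Lemma lift_sum (W : lmodType k) (g : X -> W)
    (sep : forall u : W, (forall h : {linear W -> k^o}, rel (h \o g) -> h u = 0) ->
       u = 0) (s : seq (k * X)) (v : pres) :
  pres_val v = evalsum s -> lift g v = \sum_(p <- s) p.1 *: g p.2.
Proof.
move=> vs; apply/subr0_eq/sep => h hR.
have E t : h (\sum_(p <- t) p.1 *: g p.2) = evalsum t (exist _ _ hR).
  by rewrite linear_sum; apply: eq_bigr => p _; rewrite linearZ.
by rewrite linearB /= !E -vs /rep; case: cid => t /= [_ <-]; exact: subrr.
Qed.

End Presented.

(** * Koszul signs and labelled permutations *)

Definition sgn (k : fieldType) (z : int) : k := (-1) ^ z.

(** Sign of rearranging [x_0 ... x_(r-1)], of degrees [ds], into
    [x_(s_0) x_(s_1) ...]. *)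
Definition ksign (k : fieldType) (ds : seq int) (s : seq nat) : k :=
  \prod_(i < size s)
    \prod_(j < size s | (i < j)%N && (nth 0%N s j < nth 0%N s i)%N)
      sgn k (nth 0 ds (nth 0%N s i) * nth 0 ds (nth 0%N s j)).

Definition permn (m : nat) (s : 'S_m) (j : nat) : nat :=
  if insub j is Some i then val (s i) else j.

Definition sumz (ds : seq int) : int := \sum_(d <- ds) d.

(** * Chain complexes, as internal direct sums of their homogeneous parts *)

Record dgvs (k : fieldType) := DGVS {
  dg_car :> lmodType k;
  dg_hom : int -> set dg_car;
  dg_d : {linear dg_car -> dg_car};
  dg_hom0 : forall i, dg_hom i 0;
  dg_homP : forall i a x y, dg_hom i x -> dg_hom i y -> dg_hom i (a *: x + y);
  dg_span : forall v, exists (s : seq int) (x : int -> dg_car),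
    (forall i, dg_hom i (x i)) /\ v = \sum_(i <- s) x i;
  dg_direct : forall (s : seq int) (x : int -> dg_car), uniq s ->
    (forall i, dg_hom i (x i)) -> \sum_(i <- s) x i = 0 ->
    forall i, i \in s -> x i = 0;
  dg_d_hom : forall i x, dg_hom i x -> dg_hom (i - 1) (dg_d x);
  dg_dd : forall x, dg_d (dg_d x) = 0
}.
Arguments dg_hom {k} d _ _.
Arguments dg_d {k} d.

(** * Tensor powers

    Generators of [tens A n] are words of [n] homogeneous elements recorded
    together with their degrees; the linear forms are the multilinear ones. *)
Section Tensor.
Variable k : fieldType.

Definition word (A : dgvs k) := seq (int * A).

Definition word_valid (A : dgvs k) (n : nat) (x : word A) : Prop :=
  size x = n /\
  forall i, (i < n)%N -> dg_hom A (nth (0, 0) x i).1 (nth (0, 0) x i).2.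

Definition word_rel (A : dgvs k) (n : nat) (phi : word A -> k) : Prop :=
  forall (x1 x2 : word A) (d : int) (a : k) (u v : A),
    word_valid n (x1 ++ (d, u) :: x2) -> word_valid n (x1 ++ (d, v) :: x2) ->
    phi (x1 ++ (d, a *: u + v) :: x2) =
    a * phi (x1 ++ (d, u) :: x2) + phi (x1 ++ (d, v) :: x2).

Definition tens (A : dgvs k) (n : nat) : lmodType k :=
  pres (@word_valid A n) (@word_rel A n).

Definition tgen (A : dgvs k) (n : nat) (x : word A) : tens A n :=
  gen (@word_valid A n) (@word_rel A n) x.

Definition wdegs (A : dgvs k) (x : word A) : seq int := [seq p.1 | p <- x].

Definition tens_hom (A : dgvs k) (n : nat) (i : int) (t : tens A n) : Prop :=
  span_in (fun x : word A => sumz (wdegs x) = i) t.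

Definition tens_d (A : dgvs k) (n : nat) : tens A n -> tens A n :=
  lift (fun x : word A => \sum_(i < size x)
    sgn k (sumz (take i (wdegs x))) *:
    tgen n (set_nth (0, 0) x i
              ((nth (0, 0) x i).1 - 1, dg_d A (nth (0, 0) x i).2))).

(** Multiplication by [(-1)^d] in degree [d]. *)
Definition tens_inv (A : dgvs k) (n : nat) : tens A n -> tens A n :=
  lift (fun x : word A => sgn k (sumz (wdegs x)) *: tgen n x).

(** Sends [x_0 ... x_(n-1)] to [x_(s_0) x_(s_1) ...] with its Koszul sign. *)
Definition tens_arrange (A : dgvs k) (n m : nat) (s : seq nat) :
    tens A n -> tens A m :=
  lift (fun x : word A =>
    ksign k (wdegs x) s *: tgen m [seq nth (0, 0) x i | i <- s]).

(** Left action of the symmetric group: the factor in position [i] moves to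
    position [s i]. *)
Definition tens_act (A : dgvs k) (n : nat) (s : 'S_n) : tens A n -> tens A n :=
  tens_arrange n [seq val ((s^-1)%g i) | i <- enum 'I_n].

Definition tens_cat (A : dgvs k) (p q : nat) (t : tens A p) (u : tens A q) :
    tens A (p + q) :=
  lift (fun x : word A => lift (fun y : word A => tgen (p + q) (x ++ y)) u) t.

Record hmap (A B : dgvs k) := HMap {
  h_in : nat;
  h_out : nat;
  h_deg : int;
  h_fun : tens A h_in -> tens B h_out
}.

Arguments h_fun {A B} h _.

Fixpoint tot_in (A B : dgvs k) (Fs : seq (hmap A B)) : nat :=
  if Fs is F :: Fs' then (h_in F + tot_in Fs')%N else 0%N.
Fixpoint tot_out (A B : dgvs k) (Fs : seq (hmap A B)) : nat :=
  if Fs is F :: Fs' then (h_out F + tot_out Fs')%N else 0%N.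
Definition tot_deg (A B : dgvs k) (Fs : seq (hmap A B)) : int :=
  sumz [seq h_deg F | F <- Fs].

(** Tensor product of homogeneous maps,
    [(F * G)(x * y) = (-1)^(|G||x|) F x * G y]. *)
Fixpoint tens_map (A B : dgvs k) (Fs : seq (hmap A B)) :
    tens A (tot_in Fs) -> tens B (tot_out Fs) :=
  match Fs return tens A (tot_in Fs) -> tens B (tot_out Fs) with
  | [::] => lift (fun _ : word A => tgen 0 ([::] : word B))
  | F :: Fs' => lift (fun x : word A =>
      let x1 := take (h_in F) x in
      let x2 := drop (h_in F) x in
      sgn k (tot_deg Fs' * sumz (wdegs x1)) *:
      tens_cat (h_fun F (tgen (h_in F) x1))
               (@tens_map A B Fs' (tgen (tot_in Fs') x2)))
  end.

End Tensor.

(** * S-bimodules *)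

(** Graded S-bimodules without their axioms, [sb_car M m n] having [m] outputs
    and [n] inputs. *)
Record sbdata (k : fieldType) := SBData {
  sb_car : nat -> nat -> lmodType k;
  sb_hom : forall m n, int -> sb_car m n -> Prop;
  sb_l : forall m n, 'S_m -> sb_car m n -> sb_car m n;
  sb_r : forall m n, sb_car m n -> 'S_n -> sb_car m n
}.
Arguments sb_car {k} s m n.
Arguments sb_hom {k} s {m n} _ _.
Arguments sb_l {k} s {m n} _ _.
Arguments sb_r {k} s {m n} _ _.

(** Permutations compose in diagrammatic order in MathComp: [(s * t)%g] is
    [t \o s]. *)
Record dg_sbimod (k : fieldType) := DGSBimod {
  sbm : nat -> nat -> dgvs k;
  lact : forall m n, 'S_m -> {linear sbm m n -> sbm m n};
  ract : forall m n, 'S_n -> {linear sbm m n -> sbm m n};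
  lact1 : forall m n (x : sbm m n), lact n 1%g x = x;
  ract1 : forall m n (x : sbm m n), ract m 1%g x = x;
  lactM : forall m n (s t : 'S_m) (x : sbm m n),
    lact n s (lact n t x) = lact n (t * s)%g x;
  ractM : forall m n (s t : 'S_n) (x : sbm m n),
    ract m t (ract m s x) = ract m (t * s)%g x;
  lract : forall m n (s : 'S_m) (t : 'S_n) (x : sbm m n),
    lact n s (ract m t x) = ract m t (lact n s x);
  lact_hom : forall m n i (s : 'S_m) (x : sbm m n),
    dg_hom (sbm m n) i x -> dg_hom (sbm m n) i (lact n s x);
  ract_hom : forall m n i (s : 'S_n) (x : sbm m n),
    dg_hom (sbm m n) i x -> dg_hom (sbm m n) i (ract m s x);
  lact_d : forall m n (s : 'S_m) (x : sbm m n),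
    dg_d (sbm m n) (lact n s x) = lact n s (dg_d (sbm m n) x);
  ract_d : forall m n (s : 'S_n) (x : sbm m n),
    dg_d (sbm m n) (ract m s x) = ract m s (dg_d (sbm m n) x)
}.

Definition sbdata_of (k : fieldType) (M : dg_sbimod k) : sbdata k :=
  @SBData k (fun m n => sbm M m n) (fun m n => dg_hom (sbm M m n))
    (fun m n s x => lact M n s x) (fun m n x s => ract M m s x).
Coercion sbdata_of : dg_sbimod >-> sbdata.

(** * Directed graphs with vertices labelled by an S-bimodule

    The vertices of a graph with [m] global outputs and [n] global inputs are
    totally ordered.  As the source of an edge, the port [inl i] is the [i]-th
    global input and [inr (v, j)] the [j]-th output of the vertex [v]; as a
    target, [inl i] is the [i]-th global output and [inr (v, j)] the [j]-th input
    of [v].  The map [wire] sends each source to its target; its values elsewhere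
    are irrelevant. *)

Definition port : Type := (nat + nat * nat)%type.

Section Graphs.
Variable k : fieldType.

(** [vlev] is used for 2-level graphs only ([true] on top vertices). *)
Record vertex (M : sbdata k) := Vertex {
  vout : nat;
  vin : nat;
  vdec : sb_car M vout vin;
  vdeg : int;
  vlev : bool
}.

Record dgraph (M : sbdata k) := DGraph {
  verts : seq (vertex M);
  wire : port -> port
}.

Variable M : sbdata k.
Implicit Types (D : dgraph M) (vs : seq (vertex M)) (w : port -> port).

Definition vertex0 : vertex M := @Vertex M 0 0 0 0 false.
Definition vnth vs (i : nat) : vertex M := nth vertex0 vs i.
Definition nv D : nat := size (verts D).
Definition vdegs D : seq int := [seq vdeg v | v <- verts D].
Definition gdeg D : int := sumz (vdegs D).

Definition out_ports vs (s : seq nat) : seq port :=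
  [seq inr (v, j) | v <- s, j <- iota 0 (vout (vnth vs v))].
Definition in_ports vs (s : seq nat) : seq port :=
  [seq inr (v, j) | v <- s, j <- iota 0 (vin (vnth vs v))].
Definition legs (n : nat) : seq port := [seq inl i | i <- iota 0 n].

Definition sources (n : nat) vs : seq port :=
  legs n ++ out_ports vs (iota 0 (size vs)).
Definition targets (m : nat) vs : seq port :=
  legs m ++ in_ports vs (iota 0 (size vs)).

(** Bijection between sources and targets. *)
Definition wired (m n : nat) D : bool :=
  perm_eq [seq wire D p | p <- sources n (verts D)] (targets m (verts D)).

Definition adj D : rel 'I_(nv D) := fun u v =>
  has (fun p => if wire D p is inr (v', _) then v' == v :> nat else false)
      (out_ports (verts D) [:: val u]).

Definition is_connected D : bool :=
  (0 < nv D)%N &&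
  [forall u, forall v, connect (fun a b => adj (D := D) a b || adj b a) u v].

Definition no_through (n : nat) D : bool :=
  all (fun p => if wire D p is inr _ then true else false) (legs n).

Definition acyclic D : bool :=
  [forall u, forall v, adj (D := D) u v ==> ~~ connect (@adj D) v u].

Definition reduced_graph (m n : nat) D : bool :=
  [&& wired m n D, is_connected D, no_through n D, acyclic D
    & all (fun v => ~~ vlev v) (verts D)].

(** Global inputs go to top vertices, top vertices to bottom vertices, and bottom
    vertices to global outputs. *)
Definition two_level (m n : nat) D : bool :=
  [&& wired m n D, is_connected D,
      all (fun p => if wire D p is inr (v, _) then vlev (vnth (verts D) v)
                    else false) (legs n)
    & all (fun u =>
        all (fun p => if vlev (vnth (verts D) u)
                      then (if wire D p is inr (v, _)
                            then ~~ vlev (vnth (verts D) v) else false)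
                      else (if wire D p is inl _ then true else false))
            (out_ports (verts D) [:: u]))
          (iota 0 (nv D))].

Definition dec_ok vs : Prop := forall i, (i < size vs)%N ->
  sb_hom M (vdeg (vnth vs i)) (vdec (vnth vs i)).

Definition relabel_port (v : nat) (m : nat) (s : 'S_m) (p : port) : port :=
  if p is inr (u, j) then (if u == v then inr (u, permn s j) else p) else p.

Definition move_port (s : seq nat) (p : port) : port :=
  if p is inr (u, j) then inr (nth 0%N s u, j) else p.

(** Linear forms on the space of labelled graphs: linear in each label,
    invariant under the relabelling of the half-edges at a vertex, and
    equivariant, with Koszul signs, under reordering of the vertices. *)
Definition graph_rel (n : nat) (valid : dgraph M -> Prop) (phi : dgraph M -> k) :
    Prop :=
  [/\ forall vs1 vs2 w o i d l (a : k) (x y : sb_car M o i),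
        let G z := DGraph (vs1 ++ @Vertex M o i z d l :: vs2) w in
        valid (G x) -> valid (G y) ->
        phi (G (a *: x + y)) = a * phi (G x) + phi (G y),
      forall vs1 vs2 w w' o i d l (x : sb_car M o i) (s : 'S_o) (t : 'S_i),
        let D := DGraph (vs1 ++ @Vertex M o i x d l :: vs2) w in
        let D' := DGraph (vs1 ++ @Vertex M o i (sb_r M (sb_l M s x) t) d l :: vs2)
                    w' in
        let v := size vs1 in
        valid D -> valid D' ->
        (forall p, p \in sources n (verts D) ->
           relabel_port v t (w' (relabel_port v s p)) = w p) ->
        phi D' = phi D
    & forall vs w w' (s : seq nat),
        let D := DGraph vs w in
        let D' := DGraph [seq vnth vs i | i <- s] w' in
        perm_eq s (iota 0 (size vs)) -> valid D -> valid D' ->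
        (forall p, p \in sources n (verts D') ->
           move_port s (w' p) = w (move_port s p)) ->
        phi D' = ksign k (vdegs D) s * phi D].

Definition reduced_valid (m n : nat) D : Prop :=
  reduced_graph m n D /\ dec_ok (verts D).
Definition level_valid (m n : nat) D : Prop :=
  two_level m n D /\ dec_ok (verts D).

(** The component of arity [(m, n)] of the cofree conilpotent coproperad: the sum
    over reduced connected directed graphs. *)
Definition gspace (m n : nat) : lmodType k :=
  pres (reduced_valid m n) (graph_rel n (reduced_valid m n)).
Definition ggen (m n : nat) D : gspace m n :=
  gen (reduced_valid m n) (graph_rel n (reduced_valid m n)) D.

(** The connected composition product of [M] with itself. *)
Definition boxprod (m n : nat) : lmodType k :=
  pres (level_valid m n) (graph_rel n (level_valid m n)).
Definition bgen (m n : nat) D : boxprod m n :=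
  gen (level_valid m n) (graph_rel n (level_valid m n)) D.

Definition relabel_out (m : nat) (s : 'S_m) D : dgraph M :=
  DGraph (verts D)
    (fun p => if wire D p is inl j then inl (permn s j) else wire D p).
Definition relabel_in (n : nat) (s : 'S_n) D : dgraph M :=
  DGraph (verts D)
    (fun p => if p is inl i then wire D (inl (permn s i)) else wire D p).

Definition gdata : sbdata k :=
  @SBData k gspace
    (fun m n i => span_in (fun D => gdeg D = i))
    (fun m n s => lift (fun D => ggen m n (relabel_out s D)))
    (fun m n x s => lift (fun D => ggen m n (relabel_in s D)) x).

Definition corolla (m n : nat) (x : sb_car M m n) (d : int) : dgraph M :=
  DGraph [:: @Vertex M m n x d false]
    (fun p => match p with inl i => inr (0%N, i) | inr (_, j) => inl j end).

(** ** Comultiplication of the graph comonad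

    A nesting of a graph along a list [bs] of blocks of vertices is a graph with
    one vertex per block, together with a graph inside each of these vertices,
    whose substitution gives back the original graph. *)
Record nesting := Nesting {
  n_inner : seq ((nat * nat) * (port -> port));
  n_outer : port -> port
}.

Definition n_at (N : nesting) (b : nat) : (nat * nat) * (port -> port) :=
  nth ((0%N, 0%N), id) (n_inner N) b.

Definition inner_graph (N : nesting) (bs : seq (seq nat)) D (b : nat) : dgraph M :=
  DGraph [seq vnth (verts D) i | i <- nth [::] bs b] (n_at N b).2.

End Graphs.
Arguments vertex0 {k M}.

Section Comonad.
Variable k : fieldType.
Variable M : sbdata k.

Definition outer_graph (N : nesting) (bs : seq (seq nat)) (D : dgraph M) :
    dgraph (gdata M) :=
  DGraph
    [seq (let D_b := inner_graph N bs D b in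
          @Vertex k (gdata M) (n_at N b).1.1 (n_at N b).1.2
            (ggen _ _ D_b) (gdeg D_b) false)
    | b <- iota 0 (size bs)]
    (n_outer N).

Definition enter (N : nesting) (bs : seq (seq nat)) (p : port) : port :=
  if p is inr (b, x) then
    if (n_at N b).2 (inl x) is inr (u, y)
    then inr (nth 0%N (nth [::] bs b) u, y) else inl 0%N
  else p.

Definition is_nesting (m n : nat) (bs : seq (seq nat)) (D : dgraph M)
    (N : nesting) : Prop :=
  [/\ size (n_inner N) = size bs,
      reduced_graph m n (outer_graph N bs D),
      forall b, (b < size bs)%N ->
        reduced_graph (n_at N b).1.1 (n_at N b).1.2 (inner_graph N bs D b),
      forall i, (i < n)%N -> wire D (inl i) = enter N bs (n_outer N (inl i))
    & forall b u j, (b < size bs)%N -> (u < size (nth [::] bs b))%N ->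
        let v := nth 0%N (nth [::] bs b) u in
        (j < vout (vnth (verts D) v))%N ->
        wire D (inr (v, j)) =
          match (n_at N b).2 (inr (u, j)) with
          | inr (u', y) => inr (nth 0%N (nth [::] bs b) u', y)
          | inl x => enter N bs (n_outer N (inr (b, x)))
          end].

(** The nested graph attached to a partition of the vertices; nestings along the
    same blocks differ by relabelling of half-edges, hence have the same class. *)
Definition nested (m n : nat) (bs : seq (seq nat)) (D : dgraph M) :
    gspace (gdata M) m n :=
  match pselect (exists N, is_nesting m n bs D N) with
  | left e => ksign k (vdegs D) (flatten bs) *:
              ggen m n (outer_graph (projT1 (cid e)) bs D)
  | right _ => 0
  end.

Definition blocks (r : nat) (P : {set {set 'I_r}}) : seq (seq nat) :=
  [seq [seq val v | v <- enum (B : {set 'I_r})] | B <- enum P].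

Definition comult (m n : nat) : gspace M m n -> gspace (gdata M) m n :=
  lift (fun D : dgraph M => \sum_(P : {set {set 'I_(nv D)}} |
                    finset.partition P [set: 'I_(nv D)]) nested m n (blocks P) D).

Definition map_labels (M' : sbdata k)
    (f : forall m n, sb_car M m n -> sb_car M' m n) (D : dgraph M) : dgraph M' :=
  DGraph [seq @Vertex k M' (vout v) (vin v) (f _ _ (vdec v)) (vdeg v) (vlev v)
         | v <- verts D] (wire D).

End Comonad.

(** The differential induced on labelled graphs. *)
Definition gspace_d (k : fieldType) (M : dg_sbimod k) (m n : nat) :
    gspace M m n -> gspace M m n :=
  lift (fun D : dgraph M => \sum_(i < nv D)
    sgn k (sumz (take i (vdegs D))) *:
    let v := vnth (verts D) i in
    ggen m n (DGraph (set_nth vertex0 (verts D) i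
      (@Vertex k M (vout v) (vin v) (dg_d (sbm M (vout v) (vin v)) (vdec v))
         (vdeg v - 1) (vlev v))) (wire D))).

(** * Conilpotent dg coproperads *)

Definition left_reduced (k : fieldType) (M : dg_sbimod k) : Prop :=
  forall n (x : sbm M 0 n), x = 0.
Definition right_reduced (k : fieldType) (M : dg_sbimod k) : Prop :=
  forall m (x : sbm M m 0), x = 0.

Definition coradical (k : fieldType) (M : dg_sbimod k)
    (D : forall m n, sbm M m n -> gspace M m n) (r m n : nat) (c : sbm M m n) :
    Prop :=
  span_in (fun G : dgraph M => (nv G <= r)%N) (D m n c).

(** A conilpotent dg coproperad is presented by its coaugmentation coideal and
    its comonadic decomposition map [dec], a coalgebra structure over the comonad
    of reduced connected directed graphs. *)
Record conil_coproperad (k : fieldType) := ConilCoproperad {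
  cbar : dg_sbimod k;
  dec : forall m n, {linear sbm cbar m n -> gspace cbar m n};
  cbar_reduced : left_reduced cbar \/ right_reduced cbar;
  dec_hom : forall m n i (c : sbm cbar m n),
    sb_hom cbar i c -> sb_hom (gdata cbar) i (dec m n c);
  dec_l : forall m n (s : 'S_m) (c : sbm cbar m n),
    dec m n (sb_l cbar s c) = sb_l (gdata cbar) s (dec m n c);
  dec_r : forall m n (s : 'S_n) (c : sbm cbar m n),
    dec m n (sb_r cbar c s) = sb_r (gdata cbar) (dec m n c) s;
  dec_d : forall m n (c : sbm cbar m n),
    dec m n (dg_d (sbm cbar m n) c) = gspace_d (dec m n c);
  dec_counit : forall m n i (c : sbm cbar m n), sb_hom cbar i c ->
    lift (fun D : dgraph cbar => if nv D == 1%N then ggen m n D else 0)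
      (dec m n c) = ggen m n (@corolla k cbar m n c i);
  dec_coassoc : forall m n (c : sbm cbar m n),
    lift (fun D : dgraph cbar =>
            ggen m n (@map_labels k cbar (gdata cbar) (fun o i => dec o i) D))
      (dec m n c) = comult (dec m n c);
  dec_conil : forall r m n (c : sbm cbar m n), (0 < r)%N ->
    coradical (fun o i => dec o i) r c ->
    coradical (fun o i => dec o i) r.-1 (dg_d (sbm cbar m n) c)
}.

Section Coproperad.
Variable k : fieldType.

(** The unit [I] is the space of row vectors of length 1 in arity [(1, 1)], of
    length 0 otherwise. *)
Definition unitI (m n : nat) : lmodType k := 'rV[k]_((m == 1%N) && (n == 1%N)).
Definition id_coef (m n : nat) (a : unitI m n) : k := \sum_j a 0 j.

(** [I (+) M]. *)
Definition augment (M : sbdata k) : sbdata k :=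
  @SBData k (fun m n => (unitI m n * sb_car M m n)%type)
    (fun m n i x => (x.1 = 0 \/ i = 0) /\ sb_hom M i x.2)
    (fun m n s x => (x.1, sb_l M s x.2))
    (fun m n x s => (x.1, sb_r M x.2 s)).

Variable C : conil_coproperad k.
Let Cb : sbdata k := cbar C.
Let CC : sbdata k := augment Cb.

Definition id_vertex (l : bool) : vertex CC :=
  @Vertex k CC 1 1 (const_mx 1, 0) 0 l.

(** Adding levels [lv] to the vertices of [D], identity vertices of levels [li]
    and wires [w]; it is a levelling of [D] when contracting the identities gives
    back [D]. *)
Definition levelled (D : dgraph Cb) (lv li : seq bool) (w : port -> port) :
    dgraph CC :=
  DGraph ([seq @Vertex k CC (vout v.1) (vin v.1) (0, vdec v.1) (vdeg v.1) v.2
          | v <- zip (verts D) lv] ++ [seq id_vertex l | l <- li]) w.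

Definition is_levelling (m n : nat) (D : dgraph Cb) (lv : seq bool)
    (N : seq bool * (port -> port)) : Prop :=
  let w := N.2 in
  two_level m n (levelled D lv N.1 w) /\
  forall p, p \in sources n (verts D) ->
    wire D p = (if w p is inr (v, _)
                then (if (v < nv D)%N then w p else w (inr (v, 0%N)))
                else w p).

Definition level_term (m n : nat) (D : dgraph Cb) (lv : seq bool) :
    boxprod CC m n :=
  match pselect (exists N, is_levelling m n D lv N) with
  | left e => let N := projT1 (cid e) in bgen m n (levelled D lv N.1 N.2)
  | right _ => 0
  end.

Definition id_box : dgraph CC :=
  DGraph [:: id_vertex false; id_vertex true]
    (fun p => match p with
              | inl i => inr (1%N, i)
              | inr (1%N, j) => inr (0%N, j)
              | inr (_, j) => inl j
              end).

(** The decomposition map of [C = I (+) cbar C] induced by [dec]. *)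
Definition Delta (m n : nat) (c : sb_car CC m n) : boxprod CC m n :=
  id_coef c.1 *: bgen m n id_box +
  lift (fun D : dgraph Cb =>
          \sum_(l : (nv D).-tuple bool) level_term m n D l) (dec C m n c.2).

(** * Families of maps and their composition along 2-level graphs *)

Definition fam (M : sbdata k) (A B : dgvs k) : Type :=
  forall m n, sb_car M m n -> tens A n -> tens B m.

(** [f] is homogeneous of degree [p] in [Hom_S(M, End^A_B)]. *)
Definition is_hom (M : sbdata k) (A B : dgvs k) (p : int) (f : fam M A B) : Prop :=
  [/\ forall m n a (c c' : sb_car M m n) t,
        f m n (a *: c + c') t = a *: f m n c t + f m n c' t,
      forall m n (c : sb_car M m n) a t t',
        f m n c (a *: t + t') = a *: f m n c t + f m n c t',
      forall m n i j (c : sb_car M m n) t, sb_hom M i c -> tens_hom j t ->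
        tens_hom (p + i + j) (f m n c t),
      forall m n (s : 'S_m) (c : sb_car M m n) t,
        f m n (sb_l M s c) t = tens_act s (f m n c t)
    & forall m n (s : 'S_n) (c : sb_car M m n) t,
        f m n (sb_r M c s) t = f m n c (tens_act s t)].

(** [F |-> d F - (-1)^|F| F d] on [Hom(A^n, B^m)]; conjugation by [tens_inv]
    multiplies a map of degree [|F|] by [(-1)^|F|]. *)
Definition end_d (A B : dgvs k) (m n : nat) (F : tens A n -> tens B m) :
    tens A n -> tens B m :=
  fun t => tens_d (F t) - tens_inv (F (tens_inv (tens_d t))).

(** The differential of [Hom_S(M, End^A_B)] on elements of degree [p], where [dM]
    is the differential of [M]. *)
Definition hom_d (M : sbdata k) (dM : forall m n, sb_car M m n -> sb_car M m n)
    (A B : dgvs k) (p : int) (f : fam M A B) : fam M A B :=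
  fun m n c t => end_d (f m n c) t - sgn k p *: f m n (dM m n c) t.

Definition d_cbar (m n : nat) (c : sb_car Cb m n) : sb_car Cb m n :=
  dg_d (sbm (cbar C) m n) c.
Definition d_C (m n : nat) (c : sb_car CC m n) : sb_car CC m n :=
  (0, d_cbar c.2).

Record op (A B : dgvs k) := Op { op_deg : int; op_fun : fam CC A B }.

(** [I -> End_A]. *)
Definition op_id (A : dgvs k) : op A A :=
  Op 0 (fun m n c t => id_coef c.1 *: lift (fun x : word A => tgen m x) t).

(** Extension by zero on [I]. *)
Definition op_bar (A B : dgvs k) (p : int) (f : fam Cb A B) : op A B :=
  Op p (fun m n c => f m n c.2).

Section Levels.
Variable L : dgraph CC.
Definition tops : seq nat := [seq v <- iota 0 (nv L) | vlev (vnth (verts L) v)].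
Definition bottoms : seq nat :=
  [seq v <- iota 0 (nv L) | ~~ vlev (vnth (verts L) v)].
End Levels.

Definition op_at (A B : dgvs k) (L : dgraph CC) (o : nat -> op A B) (v : nat) :
    hmap A B :=
  let x := vnth (verts L) v in
  HMap (op_deg (o v) + vdeg x) (op_fun (o v) (vdec x)).

(** Positions, in the list [from] of targets reached, of the targets [to]. *)
Definition route (from to : seq port) : seq nat := [seq index p from | p <- to].

(** Applies [bot v] to the labels of the bottom vertices and [top v] to those of
    the top vertices, and composes in the endomorphism properads.  The labels
    are first ordered with bottom vertices first; the second factor of the sign
    comes from applying the tensor product of the operations to the tensor
    product of the labels. *)
Definition compose2 (X Y Z : dgvs k) (m n : nat) (bot : nat -> op Y Z)
    (top : nat -> op X Y) (L : dgraph CC) : tens X n -> tens Z m :=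
  let vs := verts L in
  let w := wire L in
  let bs := bottoms L in
  let ts := tops L in
  let odeg v := if vlev (vnth vs v) then op_deg (top v) else op_deg (bot v) in
  let ord := bs ++ ts in
  let sign := ksign k (vdegs L) ord *
    \prod_(i < size ord) \prod_(j < size ord | (i < j)%N)
      sgn k (vdeg (vnth vs (nth 0%N ord i)) * odeg (nth 0%N ord j)) in
  fun t =>
    let t1 := tens_arrange _ (route [seq w p | p <- legs n] (in_ports vs ts)) t in
    let t2 := tens_map (Fs := [seq op_at L top v | v <- ts]) t1 in
    let t3 := tens_arrange _
      (route [seq w p | p <- out_ports vs ts] (in_ports vs bs)) t2 in
    let t4 := tens_map (Fs := [seq op_at L bot v | v <- bs]) t3 in
    sign *: tens_arrange m
      (route [seq w p | p <- out_ports vs bs] (legs m)) t4.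

(** [f * g], through the component of [Delta] with one bottom and one top vertex
    labelled by [cbar C] and all others by the identity. *)
Definition star (A : dgvs k) (p : int) (f : fam Cb A A) (q : int)
    (g : fam Cb A A) : fam Cb A A :=
  fun m n c t =>
    lift (fun L : dgraph CC => \sum_(b <- bottoms L) \sum_(u <- tops L)
            compose2 m (fun v => if v == b then op_bar p f else op_id A)
              (fun v => if v == u then op_bar q g else op_id A) L t)
      (Delta ((0, c) : sb_car CC m n)).

(** One bottom vertex with label in [cbar C], to which [bt] is applied, the other
    bottom vertices being identities; [fs] gives the operations applied to the
    top vertices, in order. *)
Definition comp_lhd (A B : dgvs k) (q : int) (bt : fam Cb B B)
    (fs : nat -> op A B) (m n : nat) (L : dgraph CC) : tens A n -> tens B m :=
  fun t => \sum_(b <- bottoms L)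
    compose2 m (fun v => if v == b then op_bar q bt else op_id B)
      (fun v => fs (index v (tops L))) L t.

Definition comp_rhd (A B : dgvs k) (fs : nat -> op A B) (q : int)
    (al : fam Cb A A) (m n : nat) (L : dgraph CC) : tens A n -> tens B m :=
  fun t => \sum_(u <- tops L)
    compose2 m (fun v => fs (index v (bottoms L)))
      (fun v => if v == u then op_bar q al else op_id A) L t.

(** * Gebras and infinity-morphisms *)

(** [bt <| f] and [f |> al] for [al] and [bt] of degree [-1] and [f] of degree 0;
    the sums over the number of [f]s start at 1, a term without [f] having no
    counterpart among the operations [k_n], [n >= 2], and the differential. *)
Definition lhd (A B : dgvs k) (bt : fam Cb B B) (f : fam CC A B) : fam CC A B :=
  fun m n c t =>
    lift (fun L : dgraph CC => if (0 < size (tops L))%N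
            then comp_lhd (-1) bt (fun=> Op 0 f) m L t else 0)
      (Delta c).

Definition rhd (A B : dgvs k) (f : fam CC A B) (al : fam Cb A A) : fam CC A B :=
  fun m n c t =>
    lift (fun L : dgraph CC => if (0 < size (bottoms L))%N
            then comp_rhd (fun=> Op 0 f) (-1) al m L t else 0)
      (Delta c).

Definition is_gebra (A : dgvs k) (al : fam Cb A A) : Prop :=
  is_hom (-1) al /\
  forall m n (c : sb_car Cb m n) (t : tens A n),
    hom_d d_cbar (-1) al c t + star (-1) al (-1) al c t = 0.

Definition is_infty_morphism (A B : dgvs k) (al : fam Cb A A) (bt : fam Cb B B)
    (f : fam CC A B) : Prop :=
  is_hom 0 f /\
  forall m n (c : sb_car CC m n) (t : tens A n),
    hom_d d_C 0 f c t = rhd f al c t - lhd bt f c t.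

(** * The shifted L-infinity algebra *)

Section Linfty.
Variables A B : dgvs k.

(** The triple [(al, f, bt)] stands for [s al + f + s bt]. *)
Record kelt := KElt { kA : fam Cb A A; kF : fam CC A B; kB : fam Cb B B }.

Definition kdeg (p : int) (x : kelt) : Prop :=
  [/\ is_hom (p - 1) (kA x), is_hom p (kF x) & is_hom (p - 1) (kB x)].

Definition kzero : kelt :=
  KElt (fun _ _ _ _ => 0) (fun _ _ _ _ => 0) (fun _ _ _ _ => 0).
Definition kadd (x y : kelt) : kelt :=
  KElt (fun m n c t => kA x c t + kA y c t)
       (fun m n c t => kF x c t + kF y c t)
       (fun m n c t => kB x c t + kB y c t).
Definition kscale (a : k) (x : kelt) : kelt :=
  KElt (fun m n c t => a *: kA x c t)
       (fun m n c t => a *: kF x c t)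
       (fun m n c t => a *: kB x c t).

(** The differential [- d], with [d (s al) = - s (d al)], on elements of degree
    [p]. *)
Definition kdiff (p : int) (x : kelt) : kelt :=
  KElt (fun m n c t => hom_d d_cbar (p - 1) (kA x) c t)
       (fun m n c t => - hom_d d_C p (kF x) c t)
       (fun m n c t => hom_d d_cbar (p - 1) (kB x) c t).

(** [[s f, s g]] for [f] and [g] of degrees [p] and [q]. *)
Definition bracket (E : dgvs k) (p : int) (f : fam Cb E E) (q : int)
    (g : fam Cb E E) : fam Cb E E :=
  fun m n c t => sgn k (p + 1) *:
    (star p f q g c t - sgn k (p * q) *: star q g p f c t).

(** The operation [U (s bt, f_1, ..., f_r)] with [bt] of degree [q]. *)
Definition opU (q : int) (bt : fam Cb B B) (fs : seq (op A B)) : fam CC A B :=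
  fun m n c t =>
    lift (fun L : dgraph CC => if size (tops L) == size fs
      then \sum_(s <- permutations (iota 0 (size fs)))
             ksign k [seq op_deg f | f <- fs] s *:
             comp_lhd q bt (fun i => nth (Op 0 (fun _ _ _ _ => 0)) fs (nth 0%N s i))
               m L t
      else 0) (Delta c).

(** The operation [D (f_1, ..., f_r, s al)] with [al] of degree [q]. *)
Definition opD (fs : seq (op A B)) (q : int) (al : fam Cb A A) : fam CC A B :=
  fun m n c t => sgn k (sumz [seq op_deg f | f <- fs]) *:
    lift (fun L : dgraph CC => if size (bottoms L) == size fs
      then \sum_(s <- permutations (iota 0 (size fs)))
             ksign k [seq op_deg f | f <- fs] s *:
             comp_rhd (fun i => nth (Op 0 (fun _ _ _ _ => 0)) fs (nth 0%N s i)) q al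
               m L t
      else 0) (Delta c).

(** The operation [k_n], [n >= 2], on [n] homogeneous elements given with their
    degrees.  By graded symmetry, each argument is moved to the first place for
    [opU], to the last one for [opD]. *)
Definition kop (xs : seq (int * kelt)) : kelt :=
  let ds := [seq x.1 | x <- xs] in
  let x_ j := nth (0, kzero) xs j in
  let others j :=
    [seq Op x.1 (kF x.2) | x <- take j xs ++ drop j.+1 xs] in
  KElt
    (fun m n c t =>
       if xs is [:: x; y]
       then bracket (x.1 - 1) (kA x.2) (y.1 - 1) (kA y.2) c t else 0)
    (fun m n c t =>
       \sum_(j < size xs)
         (sgn k ((x_ j).1 * sumz (drop j.+1 ds)) *:
            opD (others j) ((x_ j).1 - 1) (kA (x_ j).2) c t
          - sgn k ((x_ j).1 * sumz (take j ds)) *: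
            opU ((x_ j).1 - 1) (kB (x_ j).2) (others j) c t))
    (fun m n c t =>
       if xs is [:: x; y]
       then bracket (x.1 - 1) (kB x.2) (y.1 - 1) (kB y.2) c t else 0).

Definition mc_partial (x : kelt) (N : nat) : kelt :=
  kadd (kdiff 0 x)
    (\big[kadd/kzero]_(2 <= i < N) kscale (i`!%:R)^-1 (kop (nseq i (0, x)))).

(** The Maurer-Cartan series converges pointwise: on each element of [C] it has
    finitely many nonzero terms. *)
Definition is_MC (x : kelt) : Prop :=
  [/\ kdeg 0 x,
      forall m n (c : sb_car Cb m n), exists N0, forall N, (N0 <= N)%N ->
        forall t, kA (mc_partial x N) c t = 0,
      forall m n (c : sb_car CC m n), exists N0, forall N, (N0 <= N)%N ->
        forall t, kF (mc_partial x N) c t = 0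
    & forall m n (c : sb_car Cb m n), exists N0, forall N, (N0 <= N)%N ->
        forall t, kB (mc_partial x N) c t = 0].

End Linfty.

End Coproperad.

(* Main.v *)
Require Import Defs.
From mathcomp Require Import all_boot all_algebra.
Set Implicit Arguments.
Unset Strict Implicit.
Unset Printing Implicit Defensive.
Import GRing.Theory Defs.
Local Open Scope ring_scope.

(** The Maurer-Cartan equation splits into its three components.  The outer ones
    only involve the differential and half of a bracket, [[s al, s al] / 2 =
    s (al * al)], whence the two gebra equations.  In the middle one, the graded
    symmetry of [k_(r+1)] produces [(r+1)!] equal terms, so that dividing by
    [(r+1)!] leaves exactly the part of [f |> al - bt <| f] with [r] copies of
    [f]; only finitely many [r] contribute on a given element of [C], since
    [Delta c] is a finite sum of graphs. *)

Section Lift.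
Variables (k : fieldType) (X : Type) (valid : X -> Prop).
Variables (rel : (X -> k) -> Prop) (W : lmodType k).
Implicit Types (g h : X -> W) (v : pres valid rel).

(* [lift] sums over a representative chosen independently of [g], hence is
   linear in [g] whether or not [g] satisfies the relations. *)
Lemma liftZ a g v : lift (fun x => a *: g x) v = a *: lift g v.
Proof.
by rewrite /lift scaler_sumr; apply: eq_bigr => p _; rewrite !scalerA mulrC.
Qed.

Lemma eq_lift g h v : g =1 h -> lift g v = lift h v.
Proof. by move=> gh; apply: eq_bigr => p _; rewrite gh. Qed.

(** The representative [rep v] is a finite list, so the sizes occurring in it are bounded. The bound
    is chosen before [g], hence later serves every tensor [t] at once. *)
Lemma lift_sum_by_size (size_of : X -> nat) v : exists N0, forall N g,
  (N0 <= N)%N ->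
  \sum_(1 <= r < N) lift (fun x => if size_of x == r then g x else 0) v
  = lift (fun x => if (0 < size_of x)%N then g x else 0) v.
Proof.
rewrite /lift; elim: (rep v) => [|[a x] s [N0 IH]].
  by exists 0%N => N g _; rewrite big_nil big1 // => r _; rewrite big_nil.
exists (maxn (size_of x).+1 N0) => N g; rewrite geq_max => /andP[szN /IH{}IH].
under eq_bigr do rewrite big_cons.
rewrite big_split big_cons IH /=; congr (_ + _).
(* The head generator meets the single index [r = size_of x], which is below [N] by [szN]; size 0
   contributes to neither side. *)
rewrite -scaler_sumr -big_mkcond /=; congr (_ *: _).
under eq_bigl do rewrite eq_sym.
by rewrite big_nat1_eq szN andbT.
Qed.

End Lift.

Section Composition.
Variables (k : fieldType) (C : conil_coproperad k).
Notation CC := (augment (cbar C)).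
Implicit Types (L : dgraph CC).

(** Operations are read only at vertices of their own level. This matters for operations taken from
    a list by position, where other vertices get a default value. *)
Lemma eq_compose2 (X Y Z : dgvs k) (m n : nat)
    (bot bot' : nat -> op C Y Z) (top top' : nat -> op C X Y) L (t : tens X n) :
  {in bottoms L, bot =1 bot'} -> {in tops L, top =1 top'} ->
  compose2 m bot top L t = compose2 m bot' top' L t.
Proof.
move=> eqb eqt.
have Eb : [seq op_at L bot v | v <- bottoms L]
        = [seq op_at L bot' v | v <- bottoms L].
  by apply/eq_in_map => v /eqb E; rewrite /op_at E.
have Et : [seq op_at L top v | v <- tops L]
        = [seq op_at L top' v | v <- tops L].
  by apply/eq_in_map => v /eqt E; rewrite /op_at E.
rewrite /compose2 Eb Et; congr (_ * _ *: _).
(* What remains is the sign, which reads the degree of an operation at a vertex of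
   [bottoms L ++ tops L]. *)
apply: eq_bigr => i _; apply: eq_bigr => j _; congr (sgn _ (_ * _)).
have := mem_nth 0%N (ltn_ord j); rewrite mem_cat.
rewrite {1 3}/bottoms {1 3}/tops !mem_filter.
set v := nth _ _ _; case: ifP => vl; rewrite ?andbF ?orbF //= => vv.
  by rewrite eqt // mem_filter vl.
by rewrite eqb // mem_filter vl.
Qed.

Lemma ksign_deg0 (r : nat) (s : seq nat) : ksign k (nseq r 0) s = 1.
Proof.
rewrite /ksign big1 // => i _; rewrite big1 // => j _.
by rewrite !nth_nseq !if_same mul0r.
Qed.

Lemma sum_permutations_const (W : lmodType k) (r : nat) (F : seq nat -> W) w :
  {in permutations (iota 0 r), forall s, F s = w} ->
  \sum_(s <- permutations (iota 0 r)) F s = r`!%:R *: w.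
Proof.
move=> Fw; rewrite (eq_big_seq _ Fw) big_const_seq count_predT.
rewrite size_permutations ?iota_uniq // size_iota iter_addr_0.
by rewrite scaler_nat.
Qed.

Lemma nth_nseq_perm (T : Type) (x0 x : T) (r i : nat) (s : seq nat) :
  s \in permutations (iota 0 r) -> (i < r)%N ->
  nth x0 (nseq r x) (nth 0%N s i) = x.
Proof.
rewrite mem_permutations => ps ltir; rewrite nth_nseq.
suff : nth 0%N s i \in iota 0 r by rewrite mem_iota add0n => /= ->.
by rewrite -(perm_mem ps) mem_nth // (perm_size ps) size_iota.
Qed.

Variables A B : dgvs k.

(** Permuting equal arguments of degree 0 changes neither the sign nor the composite, so all [r!]
    orderings give the same term. *)
Lemma opU_nseq (q : int) (bt : fam (cbar C) B B) (f : fam CC A B) (r m n : nat)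
    (c : sb_car CC m n) (t : tens A n) :
  opU q bt (nseq r (Op 0 f)) c t =
  r`!%:R *: lift (fun L => if size (tops L) == r
    then comp_lhd q bt (fun=> Op 0 f) m L t else 0) (Delta c).
Proof.
rewrite /opU map_nseq !size_nseq -liftZ; apply: eq_lift => L.
case: eqP => [szL|_]; last by rewrite scaler0.
apply: sum_permutations_const => s sP; rewrite ksign_deg0 scale1r.
apply: eq_bigr => b _; apply: eq_compose2 => // v vL.
by rewrite nth_nseq_perm // -szL index_mem.
Qed.

Lemma opD_nseq (q : int) (al : fam (cbar C) A A) (f : fam CC A B) (r m n : nat)
    (c : sb_car CC m n) (t : tens A n) :
  opD (nseq r (Op 0 f)) q al c t =
  r`!%:R *: lift (fun L => if size (bottoms L) == r
    then comp_rhd (fun=> Op 0 f) q al m L t else 0) (Delta c).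
Proof.
rewrite /opD map_nseq !size_nseq.
rewrite /sumz big1_seq ?scale1r; last by move=> d /andP[_ /nseqP[]].
rewrite -liftZ; apply: eq_lift => L.
case: eqP => [szL|_]; last by rewrite scaler0.
apply: sum_permutations_const => s sP; rewrite ksign_deg0 scale1r.
apply: eq_bigr => u _; apply: eq_compose2 => // v vL.
by rewrite nth_nseq_perm // -szL index_mem.
Qed.

End Composition.

Section MaurerCartan.
Variables (k : fieldType) (k0 : [pchar k] =i pred0).
Variables (C : conil_coproperad k) (A B : dgvs k).
Notation CC := (augment (cbar C)).
Variables (alpha : fam (cbar C) A A) (f : fam CC A B) (beta : fam (cbar C) B B).
Let x := KElt alpha f beta.

(** Characteristic 0 enters the proof through this fact alone. *)
Lemma fact_neq0 (r : nat) : r`!%:R != 0 :> k.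
Proof. by rewrite ((pcharf0P k).1 k0) -lt0n fact_gt0. Qed.

(** In degree -1 the prefactor is [sgn k 0 = 1] and the commutator sign is [sgn k 1 = -1], so the
    two terms add up instead of cancelling. *)
Lemma half_bracket (E : dgvs k) (g : fam (cbar C) E E) (m n : nat)
    (c : sb_car (cbar C) m n) (t : tens E n) :
  (2`!%:R)^-1 *: bracket (-1) g (-1) g c t = star (-1) g (-1) g c t.
Proof.
rewrite /bracket addNr /sgn mulN1r opprK expr1z expr0z scale1r scaleN1r opprK.
by rewrite -mulr2n -scaler_nat scalerA mulVf ?scale1r ?fact_neq0.
Qed.

Lemma kA_mc_partial (N m n : nat) (c : sb_car (cbar C) m n) (t : tens A n) :
  (3 <= N)%N -> kA (mc_partial x N) c t =
  hom_d (@d_cbar k C) (-1) alpha c t + star (-1) alpha (-1) alpha c t.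
Proof.
move=> N3; rewrite /mc_partial /= sub0r; congr (_ + _).
rewrite (big_morph (fun y => kA y c t) (id1 := 0) (op1 := +%R)) //.
(* The bound 3 makes the index 2 occur; for larger indices the outer components of [kop] are
   zero. *)
rewrite big_ltn //= half_bracket big_nat_cond big1 ?addr0 //.
by move=> [|[|[|i]]] //= _; rewrite scaler0.
Qed.

Lemma kB_mc_partial (N m n : nat) (c : sb_car (cbar C) m n) (t : tens B n) :
  (3 <= N)%N -> kB (mc_partial x N) c t =
  hom_d (@d_cbar k C) (-1) beta c t + star (-1) beta (-1) beta c t.
Proof.
move=> N3; rewrite /mc_partial /= sub0r; congr (_ + _).
rewrite (big_morph (fun y => kB y c t) (id1 := 0) (op1 := +%R)) //.
rewrite big_ltn //= half_bracket big_nat_cond big1 ?addr0 //.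
by move=> [|[|[|i]]] //= _; rewrite scaler0.
Qed.

(* The r + 1 positions of the argument in s Hom(cbar, End) contribute equally,
   and the r! orderings of the copies of f do too: this cancels (r + 1)!. *)
Lemma kF_kop (r m n : nat) (c : sb_car CC m n) (t : tens A n) :
  (r.+1`!%:R)^-1 *: kF (kop (nseq r.+1 (0, x))) c t =
  lift (fun L => if size (bottoms L) == r
    then comp_rhd (fun=> Op 0 f) (-1) alpha m L t else 0) (Delta c)
  - lift (fun L => if size (tops L) == r
    then comp_lhd (-1) beta (fun=> Op 0 f) m L t else 0) (Delta c).
Proof.
set R := lift _ _; set U := lift _ _.
rewrite [kF _ c t](_ : _ = \sum_(j < r.+1) r`!%:R *: (R - U)).
  rewrite sumr_const card_ord -[_ *: _ *+ _]scaler_nat !scalerA.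
  by rewrite -natrM -factS mulVf ?scale1r ?fact_neq0.
rewrite /kop /= -[(0, x) :: _]/(nseq r.+1 (0, x)) -/(nseq _ _).
rewrite size_nseq; apply: eq_bigr => j _.
(* All arguments have degree 0, so moving the [j]-th one to either end costs no sign. *)
rewrite nth_nseq ltn_ord /= !mul0r /sgn expr0z !scale1r sub0r.
rewrite [map _ _](_ : _ = nseq r (Op 0 f)).
  by rewrite opD_nseq opU_nseq scalerBr.
rewrite -[_ :: _]/(nseq r.+1 _) take_nseq; last exact: ltnW.
by rewrite drop_nseq -nseqD map_nseq subnKC // -ltnS.
Qed.

Lemma kF_mc_partial (m n : nat) (c : sb_car CC m n) : exists N0, forall N,
  (N0 <= N)%N -> forall t : tens A n, kF (mc_partial x N) c t =
  - hom_d (@d_C k C) 0 f c t + (rhd f alpha c t - lhd beta f c t).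
Proof.
have [Nb HNb] :=
  lift_sum_by_size (tens B m) (fun L => size (bottoms L)) (Delta c).
have [Nt HNt] :=
  lift_sum_by_size (tens B m) (fun L => size (tops L)) (Delta c).
exists (maxn Nb Nt).+2 => -[//|N]; rewrite ltnS => ltN t.
rewrite /mc_partial /=; congr (_ + _).
rewrite (big_morph (fun y => kF y c t) (id1 := 0) (op1 := +%R)) //.
(* The operation of arity [r.+1] carries [r] copies of [f]: the shifted sum starts at [r = 1],
   matching the condition [0 < size _] in [rhd] and [lhd]. *)
rewrite big_add1 /=.
under eq_bigr do rewrite -/(nseq _ _) kF_kop.
move: ltN => /ltnW; rewrite geq_max => /andP[leNb leNt].
by rewrite sumrB /rhd /lhd HNb // HNt.
Qed.

End MaurerCartan.

Theorem theorem2p14 (k : fieldType) (hk : [pchar k]%R =i pred0)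
    (C : conil_coproperad k) (A B : dgvs k)
    (alpha : fam (sbdata_of (cbar C)) A A)
    (f : fam (augment (sbdata_of (cbar C))) A B)
    (beta : fam (sbdata_of (cbar C)) B B) :
  is_MC (KElt alpha f beta) <->
  [/\ is_gebra alpha, is_gebra beta & is_infty_morphism alpha beta f].
Proof.
split=> [[[]]|[[Ha al0] [Hb be0] [Hf f0]]].
  rewrite [kA _]/= [kF _]/= [kB _]/= sub0r => Ha Hf Hb al0 f0 be0.
  split; split=> // m n c t.
  (* The partial sums vanish from [N0] on and equal the left side of the gebra equation from 3 on;
     both hold at the maximum. *)
  - have [N0 H] := al0 m n c.
    by rewrite -(H (maxn N0 3) _ t) ?leq_maxl // kA_mc_partial // leq_maxr.
  - have [N0 H] := be0 m n c.
    by rewrite -(H (maxn N0 3) _ t) ?leq_maxl // kB_mc_partial // leq_maxr.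
  - have [N0 H] := f0 m n c.
    have [N1 H'] := kF_mc_partial hk alpha f beta c.
    (* The differential of the algebra is minus that of [Hom], so the middle component is the
       difference of the two sides of the morphism equation. *)
    apply/eqP; rewrite eq_sym -subr_eq0 addrC.
    by rewrite -(H' (maxn N0 N1) _ t) ?leq_maxr // H ?leq_maxl.
split; first by rewrite /kdeg /= sub0r.
- by move=> m n c; exists 3%N => N N3 t; rewrite kA_mc_partial // al0.
- move=> m n c; have [N0 H] := kF_mc_partial hk alpha f beta c.
  by exists N0 => N leN t; rewrite H // f0 addNr.
- by move=> m n c; exists 3%N => N N3 t; rewrite kB_mc_partial // be0.
Qed.
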